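(* Let $\Xi$ and $\Xi'$ be two $C^1$ Jordan curves in $\mathbb{R}^2$ surrounding the origin, and let $\Omega$ and $\Omega'$ be the bounded connected components of $\mathbb{R}^2\setminus\Xi$ and $\mathbb{R}^2\setminus\Xi'$, respectively. Assume that $\overline{\Omega'}\subset\Omega$ and let $\omega=\Omega\setminus\overline{\Omega'}$ be the non-empty and doubly connected domain located between $\Xi$ and $\Xi'$, with boundary $\partial\omega=\Xi\cup\Xi'$. Let $R'=\min_{x\in\Xi'}|x|>0$ and $R=\max_{x\in\Xi}|x|>R'$. Let $e\in\mathbb{S}^1$, let $\overline{\lambda}=\max_{x\in\Xi}x\cdot e>0$ and let $\varepsilon\in[0,\overline{\lambda})$. Let $c_1<c_2$ be real numbers and let $\varphi\in C^2(\overline{\omega})$ be a solution of $$\Delta\varphi+F(|x|,\varphi)=0\ \text{ in }\overline{\omega},\qquad c_1<\varphi<c_2\ \text{ in }\omega,\qquad \varphi=c_1\ \text{ on }\Xi,\quad \varphi=c_2\ \text{ on }\Xi',$$ with a continuous function $F:[R',R]\times[c_1,c_2]\to\mathbb{R}$ that is nonincreasing with respect to its first variable and uniformly Lipschitz continuous with respect to its second variable. Assume that $$R_{e,\lambda}(H_{e,\lambda}\cap\overline{\Omega})\subset\Omega\ \text{ for all }\lambda>\varepsilon$$ and that $$R_{e,\lambda}(H_{e,\lambda}\cap\Xi')\subset\Omega'\ \text{ for all }\lambda>\varepsilon.$$ Then, for every $\lambda\in[\varepsilon,\overline{\lambda})$, $$\varphi(x)\le\varphi_{e,\lambda}(x)=\varphi(x_{e,\lambda})\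 \text{ for all }x\in\overline{\omega_{e,\lambda}},$$ where $\omega_{e,\lambda}=(H_{e,\lambda}\cap\omega)\setminus R_{e,\lambda}(\overline{\Omega'})$.
   Context: $|\cdot|$ is the Euclidean norm and $\mathbb{S}^1$ the unit circle in $\mathbb{R}^2$. A Jordan curve $\mathcal{C}$ surrounds the origin if the bounded connected component of $\mathbb{R}^2\setminus\mathcal{C}$ contains the origin. For $e\in\mathbb{S}^1$ and $\lambda\in\mathbb{R}$, $H_{e,\lambda}=\{x\in\mathbb{R}^2:x\cdot e>\lambda\}$, and for $x\in\mathbb{R}^2$, $R_{e,\lambda}(x)=x_{e,\lambda}=x-2(x\cdot e-\lambda)e$ is the orthogonal reflection of $x$ with respect to the line $\{x\in\mathbb{R}^2:x\cdot e=\lambda\}$. ''Uniformly Lipschitz continuous with respect to its second variable'' means with a Lipschitz constant independent of the first variable. *)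

(* Defs.v *)
From HB Require Import structures.
From mathcomp Require Export all_boot all_order all_algebra.
From mathcomp Require Export all_classical all_reals all_analysis.

Set Implicit Arguments.
Unset Strict Implicit.
Unset Printing Implicit Defensive.

Export Order.TTheory GRing.Theory Num.Theory.
Export numFieldNormedType.Exports.

Local Open Scope classical_set_scope.
Local Open Scope ring_scope.

Section Plane.
Context {R : realType}.
Implicit Types (x y e : 'rV[R]_2) (C U D : set 'rV[R]_2).

Definition dotp x y : R := \sum_(i < 2) x 0 i * y 0 i.

(* The library norm `|x| on row vectors is the sup norm; it induces the same
   topology and the same bounded sets as enorm. *)
Definition enorm x : R := Num.sqrt (dotp x x).

Definition is_max (A : set R) (m : R) := A m /\ ubound A m.
Definition is_min (A : set R) (m : R) := A m /\ lbound A m.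

(* A C^1 Jordan curve is the image of the circle R/Z under an injective C^1
   immersion. *)
Definition C1_jordan_curve C : Prop :=
  exists gamma : R -> 'rV[R]_2,
    [/\ (forall t, derivable gamma t 1) /\ continuous (gamma^`())%classic,
        forall t, (gamma^`())%classic t != 0,
        forall t, gamma (t + 1) = gamma t,
        {in `[0, 1[ &, injective gamma}
      & C = range gamma].

(* For a Jordan curve C there is exactly one such U. *)
Definition bounded_component_of_compl C U : Prop :=
  (exists2 x, (~` C) x & U = connected_component (~` C) x) /\ bounded_set U.

Definition halfplane e (lambda : R) : set 'rV[R]_2 :=
  [set x | lambda < dotp x e].

Definition refl e (lambda : R) x : 'rV[R]_2 :=
  x - (2 * (dotp x e - lambda)) *: e.

Definition partial (i : 'I_2) (f : 'rV[R]_2 -> R) : 'rV[R]_2 -> R :=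
  'D_(delta_mx 0 i) f.

Definition extends_continuously D (g : 'rV[R]_2 -> R) : Prop :=
  exists2 G : 'rV[R]_2 -> R,
    {within closure D, continuous G} & forall x, D x -> G x = g x.

(* C^2 up to the boundary of the open set D: f is C^2 in D and its derivatives
   of order at most 2 extend continuously to closure D.  The values of f
   outside closure D are irrelevant. *)
Definition C2_closure D (f : 'rV[R]_2 -> R) : Prop :=
  [/\ {within closure D, continuous f},
      forall i x, D x -> derivable f x (delta_mx 0 i),
      forall i j x, D x -> derivable (partial i f) x (delta_mx 0 j),
      forall i, extends_continuously D (partial i f)
    & forall i j, extends_continuously D (partial j (partial i f))].

(* At x in closure D, the value of the continuous extension of g from D. *)
Definition ext_val D (g : 'rV[R]_2 -> R) x : R := lim (g y @[y --> within D (nbhs x)]).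

(* The Laplacian of f in C^2(closure D), including at boundary points. *)
Definition laplacian_closure D (f : 'rV[R]_2 -> R) x : R :=
  \sum_(i < 2) ext_val D (partial i (partial i f)) x.

End Plane.

(* Main.v *)
(* Write x_l for the reflection of x in the line x . e = l, and extend phi by
   c2 on the closure of Omega' and by c1 off Omega to a continuous function Phi
   on the plane.  The claim becomes W_l := Phi(x_l) - Phi(x) >= 0 on
   x . e >= l; the reflection hypotheses confine negative values of W_l to
   points with x and x_l both in omega, where |x_l| <= |x| and the equation give
   Delta W_l <= K |W_l|.

   If W_l > 0 wherever x . e >= l + delta (delta small depending on K), then
   W_l >= 0: otherwise W_l / (1 - K (x . e - l)^2) has a negative minimum inside
   the strip, against the differential inequality.  The pairs (x, l) violating
   this positivity form a compact set; if it is nonempty, take one of maximal l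
   and then of maximal x . e.  By continuity W_l >= 0 at this l, and W_l
   vanishes at x but is positive beyond the line through x orthogonal to e,
   which a Hopf-type barrier at x excludes.  Only elementary facts about the
   Jordan curves are needed: the boundary of a component lies on the curve, and
   rays from a point of a bounded component meet the curve. *)
Require Import Defs.
From mathcomp Require Import ring lra.

Set Implicit Arguments.
Unset Strict Implicit.
Unset Printing Implicit Defensive.

Local Open Scope classical_set_scope.
Local Open Scope ring_scope.

(** * Continuity, closed sets and extrema on compact sets *)

Section ContinuousFunctions.
Context {R : realType} {T : topologicalType}.

Lemma continuous_fun_id : continuous (fun x : T => x).
Proof. by move=> ?; exact: cvg_id. Qed.

Lemma continuous_fun_cst (U : topologicalType) (u : U) : continuous (fun _ : T => u).
Proof. by move=> ?; exact: cvg_cst. Qed.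

Lemma continuous_funB (V : normedModType R) (f g : T -> V) :
  continuous f -> continuous g -> continuous (fun x => f x - g x).
Proof. by move=> cf cg x; apply: cvgB; [exact: cf|exact: cg]. Qed.

Lemma continuous_funD (V : normedModType R) (f g : T -> V) :
  continuous f -> continuous g -> continuous (fun x => f x + g x).
Proof. by move=> cf cg x; apply: cvgD; [exact: cf|exact: cg]. Qed.

Lemma continuous_funM (f g : T -> R) :
  continuous f -> continuous g -> continuous (fun x => f x * g x).
Proof. by move=> cf cg x; apply: cvgM; [exact: cf|exact: cg]. Qed.

Lemma within_continuous_div (A : set T) (f g : T -> R) :
  continuous f -> continuous g -> (forall x, A x -> g x != 0) ->
  {within A, continuous (fun x => f x / g x)}.
Proof.
move=> cf cg g0; apply: continuous_in_subspaceT => x /set_mem Ax.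
by apply: cvgM; [exact: cf|apply: cvgV; [exact: g0|exact: cg]].
Qed.

Lemma closed_le_fun (f g : T -> R) :
  continuous f -> continuous g -> closed [set x | f x <= g x].
Proof.
move=> cf cg.
have -> : [set x | f x <= g x] = (fun x => g x - f x) @^-1` [set t | 0 <= t].
  by apply/seteqP; split=> x /=; rewrite subr_ge0.
apply: preimage_closed; last exact: closed_ge.
by move=> x _; exact: continuous_funB.
Qed.

Lemma open_lt_fun (f g : T -> R) :
  continuous f -> continuous g -> open [set x | f x < g x].
Proof.
move=> cf cg; rewrite -closedC.
have -> : ~` [set x | f x < g x] = [set x | g x <= f x].
  by apply/seteqP; split=> x /=; rewrite leNgt => /negP.
exact: closed_le_fun.
Qed.

Lemma near_lt_fun (f g : T -> R) x : continuous f -> continuous g -> f x < g x ->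
  \forall u \near x, f u < g u.
Proof. by move=> cf cg fg; apply: open_nbhs_nbhs; split=> //; exact: open_lt_fun. Qed.

Lemma near_preimage (U : topologicalType) (h : T -> U) (A : set U) x :
  continuous h -> open A -> A (h x) -> \forall u \near x, A (h u).
Proof. by move=> ch oA Ax; apply: ch; exact: open_nbhs_nbhs. Qed.

Lemma closed_preimage (U : topologicalType) (h : T -> U) (A : set U) :
  continuous h -> closed A -> closed [set x | A (h x)].
Proof. by move=> ch cA; apply: preimage_closed => // x _; exact: ch. Qed.

Lemma continuous_fun_comp (U V : topologicalType) (g : U -> V) (h : T -> U) :
  continuous h -> continuous g -> continuous (fun x => g (h x)).
Proof. by move=> ch cg x; apply: (continuous_comp (ch x)); exact: cg. Qed.

Lemma continuous_fun_pair (U V : topologicalType) (g : T -> U) (h : T -> V) :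
  continuous g -> continuous h -> continuous (fun x => (g x, h x)).
Proof. by move=> cg ch x; apply: cvg_pair; [exact: cg|exact: ch]. Qed.

Lemma compact_max (A : set T) (g : T -> R) : A !=set0 -> compact A ->
  continuous g -> exists2 x, A x & forall y, A y -> g y <= g x.
Proof.
move=> A0 cA cg.
have [x /set_mem Ax mx] := compact_EVT_max A0 cA (continuous_subspaceT cg).
by exists x => // y Ay; apply: mx; exact: mem_set.
Qed.

Lemma compact_min (A : set T) (g : T -> R) : A !=set0 -> compact A ->
  continuous g -> exists2 x, A x & forall y, A y -> g x <= g y.
Proof.
move=> A0 cA cg.
have [x /set_mem Ax mx] := compact_EVT_min A0 cA (continuous_subspaceT cg).
by exists x => // y Ay; apply: mx; exact: mem_set.
Qed.

End ContinuousFunctions.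

(** * Euclidean geometry of the plane *)

Section EuclideanPlane.
Context {R : realType}.
Implicit Types (x y z e : 'rV[R]_2) (a l r : R).

Lemma dotpE x y : dotp x y = x 0 0 * y 0 0 + x 0 1 * y 0 1.
Proof.
rewrite /dotp big_ord_recl big_ord1; congr (_ + x _ _ * y _ _); exact: val_inj.
Qed.

Lemma dotpC x y : dotp x y = dotp y x.
Proof. by rewrite !dotpE; ring. Qed.

Lemma dotpDl x y z : dotp (x + y) z = dotp x z + dotp y z.
Proof. by rewrite !dotpE !mxE; ring. Qed.

Lemma dotpZl a x z : dotp (a *: x) z = a * dotp x z.
Proof. by rewrite !dotpE !mxE; ring. Qed.

Lemma dotpNl x z : dotp (- x) z = - dotp x z.
Proof. by rewrite -scaleN1r dotpZl mulN1r. Qed.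

Lemma dotpDr x y z : dotp z (x + y) = dotp z x + dotp z y.
Proof. by rewrite !(dotpC z) dotpDl. Qed.

Lemma dotpZr a x z : dotp z (a *: x) = a * dotp z x.
Proof. by rewrite !(dotpC z) dotpZl. Qed.

Lemma dotpNr x z : dotp z (- x) = - dotp z x.
Proof. by rewrite !(dotpC z) dotpNl. Qed.

Lemma dot0p z : dotp 0 z = 0.
Proof. by rewrite dotpE !mxE !mul0r addr0. Qed.

Lemma dotp_ge0 x : 0 <= dotp x x.
Proof. by rewrite dotpE addr_ge0 // -expr2 sqr_ge0. Qed.

Lemma enormZ a x : 0 <= a -> enorm (a *: x) = a * enorm x.
Proof.
move=> a0; rewrite /enorm dotpZl dotpZr mulrA -expr2 sqrtrM ?sqr_ge0 //.
by rewrite sqrtr_sqr ger0_norm.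
Qed.

Lemma sum_ord2 (F : 'I_2 -> R) : \sum_(i < 2) F i = F 0 + F 1.
Proof.
by rewrite big_ord_recl big_ord1; congr (F _ + F _); exact: val_inj.
Qed.

Lemma rV2P x y : x 0 0 = y 0 0 -> x 0 1 = y 0 1 -> x = y.
Proof.
move=> h0 h1; apply/rowP => i; case: i => [[|[|//]] hi].
  by have -> : Ordinal hi = 0 by exact: val_inj.
by have -> : Ordinal hi = 1 by exact: val_inj.
Qed.

Lemma ball_rV2 x y r : 0 < r -> `|x 0 0 - y 0 0| < r -> `|x 0 1 - y 0 1| < r ->
  ball x r y.
Proof.
move=> r0 h0 h1; split=> // i j; rewrite (ord1 i).
case: j => [[|[|//]] hj].
  by have -> : Ordinal hj = 0 by exact: val_inj.
by have -> : Ordinal hj = 1 by exact: val_inj.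
Qed.

(** The library balls are sup-norm squares, and each coordinate of [y - x] is at most its Euclidean
    length. *)
Lemma ball_dotp x y r : 0 < r -> dotp (y - x) (y - x) < r ^+ 2 -> ball x r y.
Proof.
move=> r0; rewrite dotpE !mxE -!expr2 => h.
have sq a : a ^+ 2 < r ^+ 2 -> `|a| < r.
  by move=> ar; rewrite -ltr_sqr ?nnegrE ?(ltW r0) // real_normK ?num_real.
by apply: ball_rV2 => //; rewrite distrC; apply: sq; apply: le_lt_trans h;
  rewrite ?lerDl ?lerDr sqr_ge0.
Qed.

Lemma continuous_dotp (T : topologicalType) (f g : T -> 'rV[R]_2) :
  continuous f -> continuous g -> continuous (fun t => dotp (f t) (g t)).
Proof.
move=> cf cg t.
have cc (h : T -> 'rV[R]_2) j : continuous h -> (h u 0 j : R) @[u --> t] --> h t 0 j.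
  move=> ch; apply: (@cvg_comp _ _ _ h (fun M : 'rV[R]_2 => M 0 j) _ _ _ (ch t)).
  exact: coord_continuous.
rewrite /continuous_at dotpE.
under eq_fun do rewrite dotpE.
by apply: cvgD; apply: cvgM; exact: cc.
Qed.

Lemma continuous_refl e (T : topologicalType) (f : T -> 'rV[R]_2) (l : T -> R) :
  continuous f -> continuous l -> continuous (fun t => refl e (l t) (f t)).
Proof.
move=> cf cl t; rewrite /refl; apply: cvgB; first exact: cf.
apply: cvgZr_tmp; apply: cvgM; [exact: cvg_cst|apply: cvgB; last exact: cl].
by apply: (@continuous_dotp _ f (fun=> e)) => // ?; exact: cvg_cst.
Qed.

Lemma dotp_enorm1 e : enorm e = 1 -> dotp e e = 1.
Proof. by move=> he; rewrite -(sqr_sqrtr (dotp_ge0 e)) -/(enorm e) he expr1n. Qed.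

Lemma sqr_dotp_le x e : dotp e e = 1 -> dotp x e ^+ 2 <= dotp x x.
Proof.
move=> he; rewrite -subr_ge0 -[dotp x x]mulr1 -he !dotpE.
(* Lagrange's identity: the defect in Cauchy-Schwarz is a squared determinant. *)
rewrite [leRHS](_ : _ = (x 0 0 * e 0 1 - x 0 1 * e 0 0) ^+ 2) ?sqr_ge0 //; ring.
Qed.

Lemma dotp_refl e l x : enorm e = 1 -> dotp (refl e l x) e = 2 * l - dotp x e.
Proof.
by move=> /dotp_enorm1 he; rewrite dotpDl dotpNl dotpZl he; ring.
Qed.

Lemma reflK e l : enorm e = 1 -> involutive (refl e l).
Proof.
move=> he x; rewrite {1}/refl dotp_refl // /refl -addrA -opprD -scalerDl.
by rewrite [X in X *: e](_ : _ = 0) ?scale0r ?subr0 //; ring.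
Qed.

(** The squared norms differ by [4 * l * (dotp x e - l)]. This is what lets the monotonicity of [F]
    in the radius be used. *)
Lemma enorm_refl e l x : enorm e = 1 -> 0 <= l -> l <= dotp x e ->
  enorm (refl e l x) <= enorm x.
Proof.
move=> /dotp_enorm1 he l0 xl; rewrite ler_wsqrtr // /refl.
rewrite !(dotpDl, dotpDr, dotpNl, dotpNr, dotpZl, dotpZr) he (dotpC e).
rewrite -subr_ge0 [leRHS](_ : _ = 4 * l * (dotp x e - l)); last by ring.
by rewrite mulr_ge0 ?subr_ge0 // mulr_ge0.
Qed.

Lemma refl_continuous e l : continuous (refl e l).
Proof.
apply: (@continuous_refl e _ (fun x => x) (fun=> l)).
  exact: continuous_fun_id.
exact: continuous_fun_cst.
Qed.

Lemma dote_continuous e : continuous (fun x : 'rV[R]_2 => dotp x e).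
Proof.
apply: (@continuous_dotp _ (fun x => x) (fun=> e)).
  exact: continuous_fun_id.
exact: continuous_fun_cst.
Qed.

Lemma sqdist_continuous z :
  continuous (fun x : 'rV[R]_2 => dotp (x - z) (x - z)).
Proof.
have c := continuous_funB continuous_fun_id (@continuous_fun_cst 'rV[R]_2 _ z).
exact: continuous_dotp.
Qed.

Lemma refl_fixed e l x : dotp x e = l -> refl e l x = x.
Proof. by move=> h; rewrite /refl h subrr mulr0 scale0r subr0. Qed.

End EuclideanPlane.

(** * Connected components in normed spaces *)

Section Components.
Context {R : realType} {V : normedModType R}.
Implicit Types (A C U : set V) (p x v : V).

Lemma component_segment A p x v : connected_component A p x ->
  (forall t : R, 0 <= t <= 1 -> A (x + t *: v)) ->
  connected_component A p (x + v).
Proof.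
move=> px sA; apply: (connected_component_trans px).
pose B : set V := [set x + t *: v | t in `[0, 1]%classic].
apply: (@connected_component_max _ _ B).
- by exists 0; rewrite ?scale0r ?addr0 //= in_itv /= lexx ler01.
- by move=> _ [t /= t01 <-]; apply: sA; rewrite in_itv /= in t01.
- apply: connected_continuous_connected; first exact: segment_connected.
  apply: continuous_subspaceT => t; apply: cvgD; first exact: cvg_cst.
  by apply: cvgZr_tmp; exact: cvg_id.
- by exists 1; rewrite ?scale1r //= in_itv /= lexx ler01.
Qed.

Lemma component_ball A p x y (r : R) : connected_component A p x ->
  ball x r `<=` A -> ball x r y -> connected_component A p y.
Proof.
move=> px bA; rewrite -ball_normE /= => xy.
rewrite -(subrKC x y); apply: component_segment px _ => t /andP[t0 t1].
apply: bA; rewrite -ball_normE /= opprD addNKr normrN normrZ ger0_norm //.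
by apply: le_lt_trans xy; rewrite distrC ler_piMl.
Qed.

Lemma open_component A p : open A -> open (connected_component A p).
Proof.
move=> oA; rewrite openE => x px; apply/nbhs_ballP.
have : nbhs x A.
  by apply: open_nbhs_nbhs; split=> //; exact: connected_component_sub px.
move=> /nbhs_ballP[r r0 bA]; exists r => //= y.
exact: (component_ball px bA).
Qed.

(** A ball around [x] inside [A] meets the component, hence belongs to it. For the complement of a
    closed curve, this places the boundary of a component on the curve. *)
Lemma closure_component A p x : open A ->
  closure (connected_component A p) x -> A x -> connected_component A p x.
Proof.
move=> oA clx Ax.
have : nbhs x A by apply: open_nbhs_nbhs.
move=> /nbhs_ballP[r r0 bA].
have [y [py xy]] := clx _ (nbhsx_ballx x r r0).
apply: (connected_component_trans py); apply: connected_component_sym.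
by apply: (component_ball _ bA xy); exact: connected_component_refl.
Qed.

(** A ray that misses [C] stays in the component of its origin, which would then be unbounded. *)
Lemma component_ray C p x v : bounded_set (connected_component (~` C) p) ->
  connected_component (~` C) p x -> v != 0 -> exists2 t : R, 0 <= t & C (x + t *: v).
Proof.
move=> bU px v0; apply: contrapT => nC.
have /ex_strict_bound_gt0[M M0 bM] := bU.
have inU (t : R) : 0 <= t -> connected_component (~` C) p (x + t *: v).
  move=> t0; apply: component_segment px _ => s /andP[s0 _].
  by rewrite scalerA => Cs; apply: nC; exists (s * t) => //; rewrite mulr_ge0.
have v_gt0 : 0 < `|v| by rewrite normr_gt0.
(* At this parameter the displacement has norm [M + |x|], so the point reached has norm at least
   [M]. *)
have := bM _ (inU ((M + `|x|) / `|v|) _).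
rewrite divr_ge0 ?addr_ge0 ?(ltW M0) // => /(_ isT).
apply/negP; rewrite -leNgt.
have := lerB_dist (((M + `|x|) / `|v|) *: v) (- x); rewrite opprK normrN.
rewrite [X in _ <= `|X| -> _]addrC; apply: le_trans.
rewrite normrZ ger0_norm ?divr_ge0 ?addr_ge0 ?(ltW M0) //.
by rewrite divfK ?gt_eqF // addrK.
Qed.

End Components.

(** * Closedness of Jordan curves *)

Section JordanCurves.
Context {R : realType}.

(** By periodicity the curve is the continuous image of the compact interval [[0, 1]]; integer parts
    are removed with [Num.floor]. *)
Lemma C1_jordan_curve_closed (C : set 'rV[R]_2) : C1_jordan_curve C -> closed C.
Proof.
move=> [gamma [[dg _] _ pg _ ->]].
have cg : continuous gamma.
  by move=> t; apply/differentiable_continuous/derivable1_diffP/dg.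
have pgn (n : nat) t : gamma (t + n%:R) = gamma t.
  by elim: n => [|n IH]; rewrite ?addr0 // -natr1 addrA pg.
have pgz (n : int) t : gamma (t + n%:~R) = gamma t.
  by case: n => n; rewrite ?pgn // NegzE -(pgn n.+1) mulrNz subrK.
have -> : range gamma = gamma @` `[0, 1].
  rewrite eqEsubset; split=> _ [t _ <-]; last by exists t.
  exists (t + (- Num.floor t)%:~R); last exact: pgz.
  have /andP[h0 h1] := floor_itv t.
  rewrite /= in_itv /= mulrNz subr_ge0 h0 lerBlDr addrC.
  by move: h1; rewrite intrD => /ltW.
apply: compact_closed; first exact: norm_hausdorff.
apply: continuous_compact; last exact: segment_compact.
exact: continuous_subspaceT.
Qed.

End JordanCurves.

(** * Second-order expansions *)

Section Taylor.
Context {R : realType}.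

Lemma MVT_origin (g dg : R -> R) (r t : R) : `|t| < r ->
  (forall x : R, `|x| < r -> is_derive x 1 g (dg x)) ->
  exists2 c, `|c| <= `|t| & g t - g 0 = dg c * t.
Proof.
move=> tr dgP.
have H a b : `|a| < r -> `|b| < r -> a <= b ->
    exists2 c, c \in `[a, b]%R & g b - g a = dg c * (b - a).
  move=> ar br ab.
  have inr x : x \in `[a, b]%R -> `|x| < r.
    rewrite in_itv /= => /andP[ax xb]; move: ar br; rewrite !ltr_norml; lra.
  apply: MVT_segment => //.
    by move=> x xab; apply/dgP/inr; apply: subset_itv_oo_cc xab.
  by apply: derivable_within_continuous => x /inr /dgP[].
have r0 : `|0 : R| < r by rewrite normr0; apply: le_lt_trans tr.
have [t0|t0] := leP 0 t.
  have [c cI E] := H 0 t r0 tr t0; exists c; last by rewrite E subr0.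
  by move: cI; rewrite in_itv /= => /andP[c0 ct]; rewrite !ger0_norm.
have [c cI E] := H t 0 tr r0 (ltW t0); exists c.
  move: cI; rewrite in_itv /= => /andP[c0 ct].
  by rewrite ler0_norm // ltr0_norm // lerN2.
by rewrite -opprB E sub0r mulrN opprK.
Qed.

(** Two mean value steps, on [g] minus its quadratic model and then on [dg], write the remainder as
    [(ddg d - A) * c * t] with [|d| <= |c| <= |t|]. *)
Lemma taylor2_origin (g dg ddg : R -> R) (A tau r t : R) : `|t| < r ->
  (forall x : R, `|x| < r -> is_derive x 1 g (dg x)) ->
  (forall x : R, `|x| < r -> is_derive x 1 dg (ddg x)) ->
  (forall x : R, `|x| < r -> `|ddg x - A| <= tau) ->
  `|g t - g 0 - dg 0 * t - A / 2 * t ^+ 2| <= tau * t ^+ 2.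
Proof.
move=> tr g1 g2 bA.
have dp (x : R) : `|x| < r ->
    is_derive x 1 (fun x => g x - dg 0 * x - A / 2 * x ^+ 2) (dg x - dg 0 - A * x).
  move=> xr; have ? := g1 _ xr.
  have -> : (fun x => g x - dg 0 * x - A / 2 * x ^+ 2) =
      g - dg 0 \*: id - (A / 2) \*: (id ^+ 2) by [].
  apply: is_derive_eq.
  by rewrite /GRing.scale /= expr1; field.
have [c ct E] := MVT_origin tr dp.
have cr : `|c| < r by apply: le_lt_trans tr.
have [d dc E'] := MVT_origin cr g2.
have dr : `|d| < r by apply: le_lt_trans cr.
have -> : g t - g 0 - dg 0 * t - A / 2 * t ^+ 2 = (ddg d - A) * c * t.
  by rewrite mulrBl -E' -E !expr0n /=; ring.
rewrite !normrM -(real_normK (num_real t)) expr2 mulrA.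
by rewrite ler_pM // ?mulr_ge0 // ler_pM // bA.
Qed.

Lemma is_derive_line (V : normedModType R) (f : V -> R) x v (t d : R) :
  is_derive (x + t *: v) v f d -> is_derive t 1 (fun s => f (x + s *: v)) d.
Proof.
move=> [df dfE].
have E : (fun h : R => h^-1 *: (((fun s => f (x + s *: v)) \o shift t) (h *: 1)
    - f (x + t *: v))) =
  (fun h : R => h^-1 *: ((f \o shift (x + t *: v)) (h *: v) - f (x + t *: v))).
  apply/funext => h /=; congr (_ *: (f _ - _)).
  by rewrite [h%:A]mulr1 scalerDl addrCA.
by apply: DeriveDef; rewrite /derivable -?dfE /derive /= E.
Qed.

Section C2Ball.
Variables (f f0 f1 f00 f01 f11 : 'rV[R]_2 -> R) (y : 'rV[R]_2) (r tau : R).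
Hypotheses
  (d0 : forall x, ball y r x -> is_derive x (delta_mx 0 0) f (f0 x))
  (d1 : forall x, ball y r x -> is_derive x (delta_mx 0 1) f (f1 x))
  (d00 : forall x, ball y r x -> is_derive x (delta_mx 0 0) f0 (f00 x))
  (d01 : forall x, ball y r x -> is_derive x (delta_mx 0 1) f0 (f01 x))
  (d11 : forall x, ball y r x -> is_derive x (delta_mx 0 1) f1 (f11 x))
  (b00 : forall x, ball y r x -> `|f00 x - f00 y| <= tau)
  (b01 : forall x, ball y r x -> `|f01 x - f01 y| <= tau)
  (b11 : forall x, ball y r x -> `|f11 x - f11 y| <= tau).

(** The path from [y] runs first along the second axis, then along the first. Each leg has a
    one-variable expansion, and the mixed term is the change of [f0] along the first leg. *)
Lemma taylor2_rV2 (h0 h1 : R) : `|h0| < r -> `|h1| < r ->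
  `|f (y + h1 *: delta_mx 0 1 + h0 *: delta_mx 0 0) - f y
    - (f0 y * h0 + f1 y * h1)
    - (f00 y / 2 * h0 ^+ 2 + f11 y / 2 * h1 ^+ 2 + f01 y * h0 * h1)|
  <= 2 * tau * (h0 ^+ 2 + h1 ^+ 2).
Proof.
move=> h0r h1r.
have r0 : 0 < r by apply: le_lt_trans h0r.
have inB a b : `|a| < r -> `|b| < r ->
    ball y r (y + b *: delta_mx 0 1 + a *: delta_mx 0 0).
  by move=> ar br; apply: ball_rV2 => //; rewrite !mxE /= distrC;
     rewrite ?(mulr0, mulr1, addr0) addrAC subrr add0r.
have inB1 b : `|b| < r -> ball y r (y + b *: delta_mx 0 1).
  move=> br; have := inB 0 b; rewrite scale0r addr0 normr0; exact.
pose z := y + h1 *: delta_mx 0 1.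
have T0 := @taylor2_origin (fun s => f (z + s *: delta_mx 0 0))
  (fun s => f0 (z + s *: delta_mx 0 0)) (fun s => f00 (z + s *: delta_mx 0 0))
  (f00 y) tau r h0 h0r
  (fun s sr => is_derive_line (d0 (inB _ _ sr h1r)))
  (fun s sr => is_derive_line (d00 (inB _ _ sr h1r)))
  (fun s sr => b00 (inB _ _ sr h1r)).
have T1 := @taylor2_origin (fun s => f (y + s *: delta_mx 0 1))
  (fun s => f1 (y + s *: delta_mx 0 1)) (fun s => f11 (y + s *: delta_mx 0 1))
  (f11 y) tau r h1 h1r
  (fun s sr => is_derive_line (d1 (inB1 _ sr)))
  (fun s sr => is_derive_line (d11 (inB1 _ sr)))
  (fun s sr => b11 (inB1 _ sr)).
have [c ch E] := @MVT_origin (fun s => f0 (y + s *: delta_mx 0 1))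
  (fun s => f01 (y + s *: delta_mx 0 1)) r h1 h1r
  (fun s sr => is_derive_line (d01 (inB1 _ sr))).
have bc := b01 (inB1 c (le_lt_trans ch h1r)).
move: T0 T1 E bc; rewrite /= !scale0r !addr0 -/z.
set D' := f01 (_ + _) => T0 T1 E bc.
have {bc}T2 : `|(D' - f01 y) * h1 * h0| <= tau * (h0 ^+ 2 + h1 ^+ 2).
  rewrite -mulrA normrM; apply: ler_pM => //.
  rewrite ler_norml; have := sqr_ge0 (h0 + h1); have := sqr_ge0 (h0 - h1).
  have := sqr_ge0 h0; have := sqr_ge0 h1; nra.
rewrite [X in `|X|](_ : _ =
    (f (z + h0 *: delta_mx 0 0) - f z - f0 z * h0 - f00 y / 2 * h0 ^+ 2)
  + (f z - f y - f1 y * h1 - f11 y / 2 * h1 ^+ 2)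
  + (D' - f01 y) * h1 * h0); last by rewrite mulrBl -E; ring.
apply: le_trans (ler_normD _ _) _.
have := ler_normD
  (f (z + h0 *: delta_mx 0 0) - f z - f0 z * h0 - f00 y / 2 * h0 ^+ 2)
  (f z - f y - f1 y * h1 - f11 y / 2 * h1 ^+ 2).
by move: T0 T1 T2; lra.
Qed.

(* Four symmetric increments along an orthonormal frame: the first-order and
   mixed terms cancel, which is the rotation invariance of the Laplacian. *)
Lemma frame_laplacian (e e' : 'rV[R]_2) (t : R) :
  dotp e e = 1 -> e' 0 0 = - e 0 1 -> e' 0 1 = e 0 0 -> 0 <= t -> t < r ->
  `|f (y + t *: e) + f (y - t *: e) + f (y + t *: e') + f (y - t *: e')
    - 4 * f y - t ^+ 2 * (f00 y + f11 y)| <= 8 * tau * t ^+ 2.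
Proof.
move=> he e'0 e'1 t0 tr.
rewrite dotpE -!expr2 in he.
(* The expansion along one unit vector. Used for [e], [- e], [e'] and [- e'], its error
   [2 * tau * t ^+ 2] adds up to the stated bound. *)
have T (v : 'rV[R]_2) : v 0 0 ^+ 2 + v 0 1 ^+ 2 = 1 ->
  `|f (y + t *: v) - f y - t * (f0 y * v 0 0 + f1 y * v 0 1)
    - t ^+ 2 * (f00 y / 2 * v 0 0 ^+ 2 + f11 y / 2 * v 0 1 ^+ 2
                + f01 y * v 0 0 * v 0 1)| <= 2 * tau * t ^+ 2.
  move=> hv.
  have sq c : c ^+ 2 <= 1 -> `|t * c| < r.
    move=> c1; rewrite normrM ger0_norm //; apply: le_lt_trans tr.
    by rewrite ler_piMr // -(@expr_le1 _ 2) // real_normK ?num_real.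
  have h0 : `|t * v 0 0| < r by apply: sq; have := sqr_ge0 (v 0 1); lra.
  have h1 : `|t * v 0 1| < r by apply: sq; have := sqr_ge0 (v 0 0); lra.
  have := taylor2_rV2 h0 h1.
  have -> :
    y + (t * v 0 1) *: delta_mx 0 1 + (t * v 0 0) *: delta_mx 0 0 = y + t *: v.
    by apply: rV2P; rewrite !mxE /=; ring.
  rewrite [_ ^+ 2 + _ ^+ 2](_ : _ = t ^+ 2); last by rewrite -[RHS]mulr1 -hv; ring.
  by apply: le_trans; rewrite le_eqVlt; apply/orP; left; apply/eqP; congr `|_|; ring.
have he' : e' 0 0 ^+ 2 + e' 0 1 ^+ 2 = 1 by rewrite e'0 e'1 sqrrN addrC.
have hN (v : 'rV[R]_2) : v 0 0 ^+ 2 + v 0 1 ^+ 2 = 1 ->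
  (- v) 0 0 ^+ 2 + (- v) 0 1 ^+ 2 = 1 by rewrite !mxE !sqrrN.
have tri (a b c d m : R) : `|a| <= m -> `|b| <= m -> `|c| <= m -> `|d| <= m ->
  `|a + b + c + d| <= 4 * m by rewrite !ler_norml; lra.
rewrite [leRHS](_ : _ = 4 * (2 * tau * t ^+ 2)); last by ring.
apply: le_trans (tri _ _ _ _ _ (T _ he) (T _ (hN _ he)) (T _ he') (T _ (hN _ he'))).
rewrite le_eqVlt; apply/orP; left; apply/eqP; congr `|_|.
have -> : t ^+ 2 * (f00 y + f11 y) =
  t ^+ 2 * (f00 y + f11 y) * (e 0 0 ^+ 2 + e 0 1 ^+ 2) by rewrite he mulr1.
by rewrite !scalerN !mxE e'0 e'1; field.
Qed.

End C2Ball.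
End Taylor.

(** * The Laplacian of the reflected difference at a touching point *)

Section Laplacian.
Context {R : realType}.
Implicit Types (D : set 'rV[R]_2) (f : 'rV[R]_2 -> R) (x y z e : 'rV[R]_2).

Lemma extends_continuously_at D f y : open D -> D y ->
  extends_continuously D f -> {for y, continuous f}.
Proof.
move=> oD Dy [G cG Gf].
have := continuous_subspaceW (@subset_closure _ D) cG.
rewrite continuous_open_subspace // => /(_ y (mem_set Dy)) cGy.
rewrite /continuous_at Gf // in cGy.
have nD : nbhs y D by apply: open_nbhs_nbhs.
apply: cvg_trans cGy; apply: (@near_eq_cvg _ _ (nbhs y)).
by apply: filterS nD => u /Gf.
Qed.

(** At an interior point the filter within [D] is the full neighbourhood filter. *)
Lemma ext_valE D f y : open D -> D y ->
  extends_continuously D f -> ext_val D f y = f y.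
Proof.
move=> oD Dy /(extends_continuously_at oD Dy) cf.
rewrite /ext_val within_interior; last by move: oD; rewrite openE => /(_ _ Dy).
exact: cvg_lim.
Qed.

(** The quarter turn of [e], completing a unit vector to an orthonormal frame. *)
Definition rot e : 'rV[R]_2 := \row_j (if j == 0 then - e 0 1 else e 0 0).

(** By continuity the second derivatives stay within [tau / 8] of their values at [y] on some ball,
    which absorbs the factor 8 of [frame_laplacian]. *)
Lemma C2_frame_laplacian D f y e (tau : R) : open D -> C2_closure D f -> D y ->
  dotp e e = 1 -> 0 < tau ->
  exists2 r : R, 0 < r & forall t, 0 <= t -> t < r ->
  `|f (y + t *: e) + f (y - t *: e) + f (y + t *: rot e) + f (y - t *: rot e)
    - 4 * f y - t ^+ 2 * laplacian_closure D f y| <= tau * t ^+ 2.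
Proof.
move=> oD [_ d1 d2 _ d2c] Dy he tau0.
have lapE : laplacian_closure D f y =
    partial 0 (partial 0 f) y + partial 1 (partial 1 f) y.
  rewrite /laplacian_closure sum_ord2.
  exact: (f_equal2 +%R (ext_valE oD Dy (d2c 0 0)) (ext_valE oD Dy (d2c 1 1))).
have bt i j : \forall u \near y,
    D u /\ `|partial j (partial i f) u - partial j (partial i f) y| <= tau / 8.
  near=> u; split; first by near: u; exact: open_nbhs_nbhs.
  rewrite distrC; near: u.
  have := extends_continuously_at oD Dy (d2c i j).
  by move=> /cvgr_dist_le; apply; rewrite divr_gt0.
have : \forall u \near y, [/\ D u,
    `|partial 0 (partial 0 f) u - partial 0 (partial 0 f) y| <= tau / 8,
    `|partial 1 (partial 0 f) u - partial 1 (partial 0 f) y| <= tau / 8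
  & `|partial 1 (partial 1 f) u - partial 1 (partial 1 f) y| <= tau / 8].
  apply: filterS3 (bt 0 0) (bt 0 1) (bt 1 1) => u [Du h00] [_ h01] [_ h11].
  exact: (And4 Du h00 h01 h11).
move=> /nbhs_ballP[r /= r0 br]; exists r => // t t0 tr.
rewrite lapE [tau in leRHS](_ : _ = 8 * (tau / 8)); last by field.
have rot0 : rot e 0 0 = - e 0 1 by rewrite mxE.
have rot1 : rot e 0 1 = e 0 0 by rewrite mxE.
exact: (@frame_laplacian _ f (partial 0 f) (partial 1 f) (partial 0 (partial 0 f))
  (partial 1 (partial 0 f)) (partial 1 (partial 1 f)) y r (tau / 8)
  (fun u ru => let: And4 Du _ _ _ := br u ru in derivableP (d1 0 u Du))
  (fun u ru => let: And4 Du _ _ _ := br u ru in derivableP (d1 1 u Du))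
  (fun u ru => let: And4 Du _ _ _ := br u ru in derivableP (d2 0 0 u Du))
  (fun u ru => let: And4 Du _ _ _ := br u ru in derivableP (d2 0 1 u Du))
  (fun u ru => let: And4 Du _ _ _ := br u ru in derivableP (d2 1 1 u Du))
  (fun u ru => let: And4 _ h _ _ := br u ru in h)
  (fun u ru => let: And4 _ _ h _ := br u ru in h)
  (fun u ru => let: And4 _ _ _ h := br u ru in h) e (rot e) t he rot0 rot1 t0 tr).
Unshelve. all: by end_near. Qed.

(** A common shape for the strip comparison function and the Hopf barrier. For unit [e] its
    Laplacian in the plane is the constant [2 * c - 4 * d]. *)
Definition paraboloid e z (a b c d : R) x : R :=
  a + b * dotp (x - z) e + c * dotp (x - z) e ^+ 2 - d * dotp (x - z) (x - z).

Lemma paraboloid_continuous e z (a b c d : R) :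
  continuous (paraboloid e z a b c d).
Proof.
have cz := continuous_funB continuous_fun_id (@continuous_fun_cst 'rV[R]_2 _ z).
have cze : continuous (fun x : 'rV[R]_2 => dotp (x - z) e).
  by apply: continuous_dotp => //; exact: continuous_fun_cst.
have c_ (k : R) := @continuous_fun_cst 'rV[R]_2 _ k.
apply: continuous_funB; last exact: continuous_funM (c_ d) (@sqdist_continuous _ z).
apply: continuous_funD; last exact: continuous_funM (c_ c) (continuous_funM cze cze).
by apply: continuous_funD => //; exact: continuous_funM.
Qed.

(** At a point touched from below, the four symmetric increments of the reflected difference
    dominate those of the paraboloid; dividing by [t ^+ 2] compares the Laplacians up to an
    arbitrary [tau]. *)
Lemma touching_laplacian D f e (l : R) x z (a b c d : R) :
  open D -> C2_closure D f -> dotp e e = 1 -> D x -> D (refl e l x) ->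
  (\forall u \near x, paraboloid e z a b c d u <= f (refl e l u) - f u) ->
  f (refl e l x) - f x = paraboloid e z a b c d x ->
  2 * c - 4 * d <= laplacian_closure D f (refl e l x) - laplacian_closure D f x.
Proof.
move=> oD C2f he Dx Dy /nbhs_ballP[r1 /= r10 near_le] eq_x.
set Lx := laplacian_closure D f x; set Ly := laplacian_closure D f _.
have he' : dotp (rot e) (rot e) = 1 by rewrite -he !dotpE !mxE /=; ring.
have ee' : dotp (rot e) e = 0 by rewrite !dotpE !mxE /=; ring.
apply/ler_addgt0Pr => tau tau0.
have tau20 : 0 < tau / 2 by rewrite divr_gt0.
have [r2 r20 Hx] := C2_frame_laplacian oD C2f Dx he tau20.
have [r3 r30 Hy] := C2_frame_laplacian oD C2f Dy he tau20.
pose t := Num.min r1 (Num.min r2 r3) / 2.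
have t0 : 0 < t by rewrite divr_gt0 // !lt_min r10 r20.
have : t < Num.min r1 (Num.min r2 r3).
  by rewrite ltr_pdivrMr // ltr_pMr ?ltr1n // !lt_min r10 r20.
rewrite !lt_min => /and3P[tr1 tr2 tr3].
have {Hx} := Hx t (ltW t0) tr2; have {Hy} := Hy t (ltW t0) tr3.
have in_ball (v : 'rV[R]_2) : dotp v v = 1 -> ball x r1 (x + t *: v).
  move=> hv; apply: ball_dotp => //; rewrite addrAC subrr add0r.
  by rewrite dotpZl dotpZr hv mulr1 -expr2 ltr_sqr // nnegrE ltW.
have N1 (v : 'rV[R]_2) : dotp v v = 1 -> dotp (- v) (- v) = 1.
  by rewrite dotpNl dotpNr opprK.
have := near_le _ (in_ball _ he); have := near_le _ (in_ball _ (N1 _ he)).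
have := near_le _ (in_ball _ he'); have := near_le _ (in_ball _ (N1 _ he')).
(* The reflection sends [e] to [- e] and fixes [rot e], so the four increments at [x] become the
   same four, permuted, at the reflected point. *)
have reflD (v : 'rV[R]_2) :
    refl e l (x + t *: v) = refl e l x + t *: (v - (2 * dotp v e) *: e).
  by apply: rV2P; rewrite /refl !mxE dotpDl dotpZl; ring.
rewrite !reflD !dotpNl he ee' oppr0 !mulr0 mulrN mulr1 scaleNr scale0r !subr0.
have -> : - e - - (2 *: e) = e by apply: rV2P; rewrite !mxE; ring.
have -> : e - 2 *: e = - e by apply: rV2P; rewrite !mxE; ring.
rewrite !scalerN.
(* The expansion is exact; over the four directions the first-order terms cancel and the others add
   up to [t ^+ 2 * (2 * c - 4 * d)]. *)
have Q (v : 'rV[R]_2) : dotp v v = 1 -> paraboloid e z a b c d (x + t *: v) =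
    paraboloid e z a b c d x
    + t * (b * dotp v e + 2 * c * dotp (x - z) e * dotp v e - 2 * d * dotp (x - z) v)
    + t ^+ 2 * (c * dotp v e ^+ 2 - d).
  move=> hv; rewrite /paraboloid [_ + t *: v - z]addrAC.
  rewrite !(dotpDl (x - z)) !(dotpDr (x - z)) !(dotpZl, dotpZr) hv.
  by rewrite (dotpC v (x - z)); ring.
rewrite -[- (t *: e)]scalerN -[- (t *: rot e)]scalerN.
rewrite (Q _ he) (Q _ he') (Q _ (N1 _ he)) (Q _ (N1 _ he')) !dotpNl ee' he -eq_x.
rewrite !dotpNr -/Lx -/Ly !scalerN.
rewrite !(oppr0, mulr0, mulr1, mulrN, addr0, sub0r, opprK, expr0n, sqrrN, expr1n) /=.
move: (f (refl e l x + t *: e)) (f (refl e l x - t *: e))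
  (f (refl e l x + t *: rot e)) (f (refl e l x - t *: rot e)) (f (refl e l x))
  (f (x + t *: e)) (f (x - t *: e)) (f (x + t *: rot e)) (f (x - t *: rot e)) (f x).
move: (dotp _ e) (dotp _ (rot e)) => p p' y1 y2 y3 y4 y0 x1 x2 x3 x4 x0.
clearbody t Lx Ly; rewrite !ler_norml => h1 h2 h3 h4 hy hx.
rewrite -(ler_pM2l (exprn_gt0 2 t0)).
by move: h1 h2 h3 h4 hy hx; lra.
Qed.

End Laplacian.

(** * Moving planes *)

Section MovingPlanes.
Context {R : realType}.
(** The roles are: [D] is the annular domain, [f] the solution, [Phi] its extension to the plane,
    and [lo], [hi] the ends of the range of mirror positions. The geometry of the curves enters only
    through the two [_interior] hypotheses and [D_hi]. *)
Variables (D : set 'rV[R]_2) (f Phi : 'rV[R]_2 -> R) (e : 'rV[R]_2).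
Variables (K lo hi : R).
Hypotheses (D_open : open D) (D_bounded : bounded_set D) (f_C2 : C2_closure D f).
Hypotheses (Phi_cont : continuous Phi) (Phi_eq : forall x, D x -> Phi x = f x).
Hypotheses (e1 : enorm e = 1) (K_gt0 : 0 < K).
Hypothesis D_hi : forall x, closure D x -> dotp x e <= hi.
Hypothesis neg_interior : forall l x, lo < l -> l <= dotp x e ->
  Phi (refl e l x) < Phi x -> D x /\ D (refl e l x).
Hypothesis nonpos_interior : forall l x, lo < l -> l < dotp x e ->
  closure D x -> closure D (refl e l x) -> Phi (refl e l x) <= Phi x ->
  D x /\ D (refl e l x).
Hypothesis laplacian_diff : forall l x, lo < l -> l <= dotp x e ->
  D x -> D (refl e l x) ->
  laplacian_closure D f (refl e l x) - laplacian_closure D f x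
  <= K * `|Phi (refl e l x) - Phi x|.

Let e_unit : dotp e e = 1 := dotp_enorm1 e1.

Definition reflection_increases l := forall x,
  l <= dotp x e -> Phi x <= Phi (refl e l x).

Lemma Phi_refl_continuous l : continuous (fun x => Phi (refl e l x)).
Proof.
move=> x; apply: (@continuous_comp _ _ _ (refl e l) Phi); last exact: Phi_cont.
exact: refl_continuous.
Qed.

Lemma closure_bounded_compact (A : set 'rV[R]_2) :
  closed A -> A `<=` closure D -> compact A.
Proof.
move=> cA AD; apply: bounded_closed_compact => //.
have /ex_strict_bound_gt0[M M0 bM] := D_bounded.
exists (M + 1); split; first exact: num_real.
move=> r Mr x /AD /(_ _ (nbhsx_ballx x 1 ltr01)) [y [/bM /= yM xy]].
rewrite -ball_normE /= in xy.
have := lerB_dist x y; lra.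
Qed.

Lemma near_D_refl l (x : 'rV[R]_2) : D x -> D (refl e l x) ->
  \forall u \near x, D u /\ D (refl e l u).
Proof.
move=> Dx Dy; have nx : nbhs x D by apply: open_nbhs_nbhs.
have ny := near_preimage (@refl_continuous _ e l) D_open Dy.
by apply: filterS2 nx ny => u Du Dv; split.
Qed.

(** The touching bound chained with the differential inequality; the strip and the Hopf arguments
    each contradict its conclusion. *)
Lemma touching_difference l x z (a b c d : R) : lo < l -> l <= dotp x e ->
  D x -> D (refl e l x) ->
  (\forall u \near x, paraboloid e z a b c d u <= Phi (refl e l u) - Phi u) ->
  Phi (refl e l x) - Phi x = paraboloid e z a b c d x ->
  2 * c - 4 * d <= K * `|Phi (refl e l x) - Phi x|.
Proof.
move=> lol lx Dx Dy nle eqx.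
apply: le_trans (laplacian_diff lol lx Dx Dy).
apply: (@touching_laplacian _ D f e l x z a b c d) => //.
  apply: filterS2 nle (near_D_refl Dx Dy) => u h [Du Dv].
  by rewrite -!Phi_eq.
by rewrite -!Phi_eq.
Qed.

(** If [- mu] is a negative minimum of the quotient by [g], then [- mu * g] touches the difference
    from below. Its Laplacian is [2 * mu * K], while the differential inequality allows at most
    [K * mu * g], and [g <= 1]. *)
Lemma strip_principle l delta : lo < l -> 0 < delta -> 2 * K * delta ^+ 2 <= 1 ->
  (forall x, closure D x -> closure D (refl e l x) -> l + delta <= dotp x e ->
     Phi x < Phi (refl e l x)) ->
  reflection_increases l.
Proof.
move=> lol delta0 Kdelta far x0 lx0; rewrite leNgt; apply/negP => neg.
(* Negative points lie off the mirror, where the difference vanishes, and outside the far region, so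
   the minimum found below is interior to the strip. *)
have inside x : l <= dotp x e -> Phi (refl e l x) < Phi x ->
    [/\ D x, D (refl e l x), l < dotp x e & dotp x e < l + delta].
  move=> lx nx; have [Dx Dy] := neg_interior lol lx nx; split=> //.
    rewrite lt_neqAle lx andbT; apply/eqP => h.
    by move: nx; rewrite refl_fixed ?ltxx.
  rewrite ltNge; apply/negP => /far; move/(_ (subset_closure Dx) (subset_closure Dy)).
  by move=> /(lt_trans nx); rewrite ltxx.
pose A := closure D `&` ([set x | l <= dotp x e] `&` [set x | dotp x e <= l + delta]).
have cA : closed A.
  apply: closedI; first exact: closed_closure.
  by apply: closedI; apply: closed_le_fun;
    by [exact: dote_continuous | exact: continuous_fun_cst].
have Ak : compact A by apply: closure_bounded_compact => // x [].
(* The condition on [delta] gives [g >= 1 / 2] on the strip. *)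
pose g x := 1 - K * (dotp x e - l) ^+ 2.
have g_gt0 x : A x -> 0 < g x.
  move=> [_ [/= h1 h2]]; rewrite /g subr_gt0.
  apply: (@le_lt_trans _ _ (K * delta ^+ 2)); last by lra.
  by rewrite ler_pM2l // ler_sqr ?nnegrE ?subr_ge0 ?(ltW delta0) // lerBlDl.
have cs := continuous_funB (@dote_continuous _ e) (@continuous_fun_cst 'rV[R]_2 _ l).
have cg : continuous g.
  have c2 := continuous_funM (@continuous_fun_cst 'rV[R]_2 _ K) (continuous_funM cs cs).
  exact: (continuous_funB (@continuous_fun_cst 'rV[R]_2 _ (1 : R)) c2).
pose h x := (Phi (refl e l x) - Phi x) / g x.
have ch : {within A, continuous h}.
  apply: within_continuous_div => //.
    by apply: continuous_funB => //; exact: Phi_refl_continuous.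
  by move=> x /g_gt0; rewrite lt0r => /andP[].
have Ax0 : A x0.
  by have [D0 _ h1 h2] := inside _ lx0 neg; split; [exact: subset_closure|split; apply: ltW].
have A0 : A !=set0 by exists x0.
have [x1 /set_mem Ax1 x1min] := EVT_min_rV A0 Ak ch.
pose mu := - h x1.
have mu0 : 0 < mu.
  rewrite oppr_gt0; apply: le_lt_trans (x1min x0 (mem_set Ax0)) _.
  by rewrite ltr_pdivrMr ?mul0r ?subr_lt0 // g_gt0.
have W1 : Phi (refl e l x1) - Phi x1 = - mu * g x1.
  by rewrite /mu opprK /h divfK // gt_eqF // g_gt0.
have neg1 : Phi (refl e l x1) < Phi x1.
  by rewrite -subr_lt0 W1 mulNr oppr_lt0 mulr_gt0 // g_gt0.
have [D1 D1' l1 r1] := inside _ Ax1.2.1 neg1.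
have := @touching_difference l x1 (l *: e) (- mu) 0 (mu * K) 0 lol (ltW l1) D1 D1'.
have pE u : paraboloid e (l *: e) (- mu) 0 (mu * K) 0 u = - mu * g u.
  by rewrite /paraboloid dotpDl dotpNl dotpZl e_unit /g; ring.
have near_touch : \forall u \near x1,
    paraboloid e (l *: e) (- mu) 0 (mu * K) 0 u <= Phi (refl e l u) - Phi u.
  have n1 := near_lt_fun (@continuous_fun_cst _ _ l) (@dote_continuous _ e) l1.
  have n2 := near_lt_fun (@dote_continuous _ e) (@continuous_fun_cst _ _ (l + delta)) r1.
  have n3 : nbhs x1 D by apply: open_nbhs_nbhs.
  apply: filterS3 n1 n2 n3 => u lu ur Du.
  have Au : A u by split; [exact: subset_closure|split; apply: ltW].
  by rewrite pE -ler_pdivlMr ?g_gt0 // /mu opprK x1min // mem_set.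
move=> /(_ near_touch); rewrite pE => /(_ W1); rewrite W1 normrM normrN.
rewrite !gtr0_norm ?g_gt0 //.
have : g x1 <= 1 by rewrite /g gerBl mulr_ge0 ?sqr_ge0 // ltW.
rewrite mulr0 subr0 (mulrCA K) -subr_ge0 => h1.
have : 0 < mu * K by rewrite mulr_gt0.
nra.
Qed.

(** For fixed [x] strictly beyond the mirror, a strict violation at [l] persists for slightly larger
    mirror positions, by continuity in the position. *)
Lemma reflection_increases_limit l m : l < m ->
  (forall k, l < k < m -> reflection_increases k) -> reflection_increases l.
Proof.
move=> lm inc x; rewrite le_eqVlt => /predU1P[h|lx]; first by rewrite refl_fixed.
rewrite leNgt; apply/negP => neg.
have cPhi : continuous (fun k : R => Phi (refl e k x)).
  apply: continuous_fun_comp (Phi_cont).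
  apply: (@continuous_refl R e _ (fun=> x) (fun k => k)).
    exact: continuous_fun_cst.
  exact: continuous_fun_id.
have /nbhs_ballP[r /= r0 near_l] := near_lt_fun cPhi (@continuous_fun_cst _ _ (Phi x)) neg.
pose s := Num.min r (Num.min (m - l) (dotp x e - l)).
have s0 : 0 < s by rewrite !lt_min r0 !subr_gt0 lm lx.
have [h1 h2 h3] : [/\ s <= r, s <= m - l & s <= dotp x e - l].
  by rewrite /s !ge_min !lexx !orbT.
have : Phi (refl e (l + s / 2) x) < Phi x.
  by apply: near_l; rewrite -ball_normE /= opprD addNKr normrN gtr0_norm; lra.
by apply/negP; rewrite -leNgt; apply: inc; lra.
Qed.

(* Hopf's lemma in disguise: near a zero [z] of the reflected difference that is
   extremal in direction [e], the difference would dominate a multiple of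
   [s + 3 s ^ 2 - |x - z| ^ 2 + r ^ 2 / 2] on the circle of radius [r], with
   [s = (x - z) . e]; this function is subharmonic and positive at [z]. *)
Lemma extremal_zero_absurd l z : lo < l -> l < dotp z e ->
  reflection_increases l -> D z -> D (refl e l z) -> Phi (refl e l z) <= Phi z ->
  (forall u, D u -> D (refl e l u) -> dotp z e < dotp u e ->
     Phi u < Phi (refl e l u)) -> False.
Proof.
move=> lol lz inc Dz Dz' z_le beyond.
have n1 := near_D_refl Dz Dz'.
have n2 := near_lt_fun (@continuous_fun_cst _ _ l) (@dote_continuous _ e) lz.
have /nbhs_ballP[rho /= rho0 brho] : \forall u \near z,
    [/\ D u, D (refl e l u) & l < dotp u e].
  by apply: filterS2 n1 n2 => u [Du Du'] lu; split.
(* The bound [rho / 2] keeps the disc [S] in the good region, [1 / 4] controls the quadratic terms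
   of the barrier, and [K^-1] makes its Laplacian prevail over the term in [K]. *)
pose r := Num.min (rho / 2) (Num.min (1 / 4) K^-1).
have r0 : 0 < r by rewrite !lt_min invr_gt0 K_gt0; apply/and3P; split=> //; lra.
have [h1 h2 h3] : [/\ r <= rho / 2, r <= 1 / 4 & r <= K^-1].
  by rewrite /r !ge_min !lexx !orbT.
have Kr : K * r <= 1 by rewrite mulrC -ler_pdivlMr // div1r.
pose S := [set u | dotp (u - z) (u - z) <= r ^+ 2].
have inS u : S u -> [/\ D u, D (refl e l u) & l < dotp u e].
  move=> Su; apply: brho; apply: ball_dotp => //; apply: le_lt_trans Su _.
  by rewrite ltr_sqr ?nnegrE; lra.
have cS : closed S.
  exact: closed_le_fun (@sqdist_continuous _ z) (@continuous_fun_cst _ _ (r ^+ 2)).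
have kS : compact S.
  by apply: closure_bounded_compact => // u /inS[Du _ _]; exact: subset_closure.
have sle u : S u -> `|dotp (u - z) e| <= r.
  move=> Su; rewrite -ler_sqr ?nnegrE // ?(ltW r0) // real_normK ?num_real //.
  exact: le_trans (sqr_dotp_le _ e_unit) Su.
pose W u := Phi (refl e l u) - Phi u.
have cW : continuous W := continuous_funB (@Phi_refl_continuous l) Phi_cont.
have W_ge0 u : S u -> 0 <= W u.
  by move=> /inS[_ _ lu]; rewrite subr_ge0; apply: inc; apply: ltW.
(* On this compact cap [beyond] makes [W] positive, so its minimum [eta] there is positive. *)
pose C := S `&` [set u | r ^+ 2 / 4 <= dotp (u - z) e].
have kC : compact C.
  apply: closure_bounded_compact; last first.
    by move=> u [/inS[Du _ _] _]; exact: subset_closure.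
  apply: closedI => //; apply: closed_le_fun; first exact: continuous_fun_cst.
  have cz := continuous_funB continuous_fun_id (@continuous_fun_cst 'rV[R]_2 _ z).
  apply: continuous_dotp => //; exact: continuous_fun_cst.
have C0 : C !=set0.
  exists (z + r *: e); split.
    by rewrite /S /= addrAC subrr add0r dotpZl dotpZr e_unit mulr1 expr2.
  by rewrite /= addrAC subrr add0r dotpZl e_unit mulr1; nra.
have [u0 [Su0 Cu0] u0min] := compact_min C0 kC cW.
pose eta := W u0.
have eta0 : 0 < eta.
  have [Du Du' _] := inS _ Su0; rewrite subr_gt0; apply: beyond => //.
  move: Cu0; rewrite /= dotpDl dotpNl; have := exprn_gt0 2 r0; lra.
pose h := paraboloid e z (r ^+ 2 / 2) 1 3 1.
have h_le u : S u -> h u <= 2 * r.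
  move=> Su; rewrite /h /paraboloid; have := sle _ Su; have := dotp_ge0 (u - z).
  rewrite ler_norml => d0 /andP[s1 s2].
  have : dotp (u - z) e ^+ 2 <= r ^+ 2 := le_trans (sqr_dotp_le _ e_unit) Su.
  nra.
have ch : continuous h := @paraboloid_continuous _ e z _ _ _ _.
have cv : continuous (fun u => W u - eta * h u).
  exact: continuous_funB cW (continuous_funM (@continuous_fun_cst 'rV[R]_2 _ eta) ch).
have Sz : S z by rewrite /S /= subrr dot0p; apply: sqr_ge0.
have [x1 Sx1 x1min] := compact_min (ex_intro _ z Sz) kS cv.
set v1 := W x1 - eta * h x1 in x1min *.
have v1_lt0 : v1 < 0.
  apply: le_lt_trans (x1min z Sz) _.
  have -> : h z = r ^+ 2 / 2 by rewrite /h /paraboloid subrr !dot0p; ring.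
  have : W z <= 0 by rewrite subr_le0.
  have : 0 < eta * (r ^+ 2 / 2) by rewrite mulr_gt0 // divr_gt0 // exprn_gt0.
  lra.
have x1_int : dotp (x1 - z) (x1 - z) < r ^+ 2.
  (* On the circle, either [h <= 0] and [W >= 0] suffices, or [h > 0]. As [r <= 1 / 4], the latter
     forces the point into [C], where [W >= eta >= eta * h]. *)
  rewrite lt_neqAle Sx1 andbT; apply/eqP => x1r.
  move: v1_lt0; apply/negP; rewrite -leNgt subr_ge0.
  have [hneg|hpos] := leP (h x1) 0.
    by apply: le_trans (W_ge0 _ Sx1); rewrite pmulr_rle0.
  apply: (@le_trans _ _ eta).
    by rewrite ler_piMr ?(ltW eta0) //; have := h_le _ Sx1; lra.
  apply: u0min; split=> //=.
  move: hpos; rewrite /h /paraboloid x1r; have := sle _ Sx1.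
  rewrite ler_norml => /andP[s1 s2]; nra.
have [D1 D1' l1] := inS _ Sx1.
have pE u : paraboloid e z (v1 + eta * (r ^+ 2 / 2)) eta (3 * eta) eta u =
    v1 + eta * h u by rewrite /h /paraboloid; ring.
have near_touch : \forall u \near x1,
    paraboloid e z (v1 + eta * (r ^+ 2 / 2)) eta (3 * eta) eta u
    <= Phi (refl e l u) - Phi u.
  have n := near_lt_fun (@sqdist_continuous _ z) (@continuous_fun_cst _ _ (r ^+ 2)) x1_int.
  by apply: filterS n => u /ltW /x1min H; rewrite pE -lerBrDr; exact: H.
have W1 : Phi (refl e l x1) - Phi x1 = v1 + eta * h x1 by rewrite /v1 subrK.
have := @touching_difference l x1 z _ _ _ _ lol (ltW l1) D1 D1' near_touch.
rewrite pE => /(_ W1).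
rewrite W1 ger0_norm; last by rewrite -W1; exact: W_ge0.
apply/negP; rewrite -ltNge.
(* The barrier has Laplacian [6 * eta - 4 * eta = 2 * eta], whereas [K * W] at [x1] is below
   [2 * eta] because [v1 < 0] and [K * r <= 1]. *)
apply: (@le_lt_trans _ _ (K * (v1 + eta * (2 * r)))).
  by rewrite ler_pM2l // lerD2l ler_pM2l // h_le.
have : K * v1 < 0 by rewrite pmulr_rlt0.
have : eta * (K * r) <= eta by rewrite ler_piMr // ltW.
lra.
Qed.

Theorem moving_planes l : lo <= l < hi -> reflection_increases l.
Proof.
(* It suffices to treat mirrors [l0] strictly above [lo], where the hypotheses apply; they then hold
   on the whole compact range from [l0] to [hi]. *)
move=> /andP[lol lhi]; apply: (reflection_increases_limit lhi) => l0 /andP[l0l l0hi].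
have {lol l0l}lo0 : lo < l0 by apply: le_lt_trans l0l.
have [delta delta0 Kdelta] : exists2 delta, 0 < delta & 2 * K * delta ^+ 2 <= 1.
  (* As [d <= 1], one has [d ^+ 2 <= d <= (2 * K)^-1]. *)
  pose d := Num.min 1 (2 * K)^-1.
  have d0 : 0 < d by rewrite lt_min ltr01 invr_gt0 mulr_gt0.
  have [h1 h2] : d <= 1 /\ d <= (2 * K)^-1 by rewrite /d !ge_min !lexx !orbT.
  exists d => //; apply: (@le_trans _ _ (2 * K * d)).
    by rewrite ler_pM2l ?mulr_gt0 // expr2 ler_piMr // ltW.
  by rewrite mulrC -ler_pdivlMr ?mulr_gt0 // div1r.
(* Pairs of a point and a mirror that violate the far-region hypothesis of [strip_principle]. *)
pose B := [set p : 'rV[R]_2 * R | closure D p.1] `&`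
  [set p | closure D (refl e p.2 p.1)] `&` [set p | l0 <= p.2 <= hi] `&`
  [set p | p.2 + delta <= dotp p.1 e] `&` [set p | Phi (refl e p.2 p.1) <= Phi p.1].
have c1 : continuous (fun p : 'rV[R]_2 * R => p.1) by move=> p; exact: cvg_fst.
have c2 : continuous (fun p : 'rV[R]_2 * R => p.2) by move=> p; exact: cvg_snd.
have cr : continuous (fun p : 'rV[R]_2 * R => refl e p.2 p.1).
  exact: continuous_refl.
have cd : continuous (fun p : 'rV[R]_2 * R => dotp p.1 e).
  by apply: continuous_dotp => //; exact: continuous_fun_cst.
have clB : closed B.
  apply: closedI; last first.
    apply: closed_le_fun; first exact: continuous_fun_comp cr Phi_cont.
    exact: continuous_fun_comp c1 Phi_cont.
  apply: closedI; last first.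
    apply: closed_le_fun => //; apply: continuous_funD => //.
    exact: continuous_fun_cst.
  apply: closedI; last first.
    have -> : [set p : 'rV[R]_2 * R | l0 <= p.2 <= hi] =
        [set p | l0 <= p.2] `&` [set p | p.2 <= hi].
      by apply/seteqP; split=> p /= /andP.
    by apply: closedI; apply: closed_le_fun => //; exact: continuous_fun_cst.
  by apply: closedI; apply: closed_preimage => //; exact: closed_closure.
have kB : compact B.
  apply: (@subclosed_compact _ B (closure D `*` `[l0, hi])) => //.
    apply: compact_setX; last exact: segment_compact.
    by apply: closure_bounded_compact => //; exact: closed_closure.
  by move=> [x k] [[[[Dx _] kI] _] _]; split=> //=; rewrite in_itv.
have good k : l0 <= k < hi -> (forall x, ~ B (x, k)) -> reflection_increases k.
  move=> /andP[l0k khi] nB; apply: (strip_principle _ delta0 Kdelta).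
    exact: lt_le_trans l0k.
  move=> x Dx Dx' kx; rewrite ltNge; apply/negP => le_x.
  by apply: (nB x); do !split => //=; rewrite l0k ltW.
have [[x0 BB]|nB] := pselect (B !=set0); last first.
  by apply: good => [|x Bx]; [rewrite lexx|apply: nB; exists (x, l0)].
have [[x1 l1] B1 l1max] := compact_max (ex_intro _ x0 BB) kB c2.
have [[[[Dx1 _] l1I] l1x1] _] := B1.
move: l1I => /= /andP[l0l1 _].
have l1hi : l1 < hi.
  by apply: lt_le_trans (D_hi Dx1); apply: lt_le_trans l1x1; rewrite ltrDl.
have lo1 : lo < l1 by apply: lt_le_trans l0l1.
(* By maximality of [l1], no mirror strictly between [l1] and [hi] has a bad pair; pass to the
   limit. *)
have inc1 : reflection_increases l1.
  apply: (reflection_increases_limit l1hi) => k /andP[l1k khi]; apply: good.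
    by rewrite khi (le_trans l0l1) // ltW.
  by move=> x /l1max /=; rewrite leNgt l1k.
have clB1 : closed [set x | B (x, l1)].
  apply: closed_preimage => //.
  by apply: continuous_fun_pair; [exact: continuous_fun_id|exact: continuous_fun_cst].
have kB1 : compact [set x | B (x, l1)].
  by apply: closure_bounded_compact => // x [[[[]]]].
have [z Bz zmax] := compact_max (ex_intro _ x1 B1) kB1 (@dote_continuous _ e).
have [[[[Dz Dz'] _] l1z] z_le] := Bz.
have {}l1z : l1 < dotp z e by apply: lt_le_trans l1z; rewrite ltrDl.
have [Dz0 Dz0'] := nonpos_interior lo1 l1z Dz Dz' z_le.
exfalso; apply: (extremal_zero_absurd lo1 l1z inc1 Dz0 Dz0' z_le).
(* Such a [u] would form a bad pair with [l1] and lie further than [z] in direction [e]. *)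
move=> u Du Du' zu; rewrite ltNge; apply/negP => u_le.
have Bu : B (u, l1).
  have [[_ h] _] := Bz; split; last exact: u_le.
  split; last exact: le_trans h (ltW zu).
  split; last by have [[[_ hI] _] _] := Bz; exact: hI.
  by split; exact: subset_closure.
by have := zmax _ Bu; rewrite leNgt zu.
Qed.

End MovingPlanes.

(** * Extension of the solution to the plane *)

Lemma extension_by_constants (R : realType) (T : topologicalType)
    (Om Om' : set T) (phi : T -> R) (c1 c2 : R) :
  open Om -> open Om' -> closure Om' `<=` Om ->
  {within closure (Om `\` closure Om'), continuous phi} ->
  (forall x, closure Om x -> ~ Om x -> phi x = c1) ->
  (forall x, closure Om' x -> ~ Om' x -> phi x = c2) ->
  exists Phi : T -> R, [/\ continuous Phi,
    forall x, closure (Om `\` closure Om') x -> Phi x = phi x,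
    forall x, ~ Om x -> Phi x = c1 & forall x, closure Om' x -> Phi x = c2].
Proof.
move=> oOm oOm' sub cphi phi1 phi2.
set D := Om `\` closure Om'.
pose Phi x := if x \in closure Om' then c2 else if x \in Om then phi x else c1.
have out x : ~ Om x -> Phi x = c1.
  move=> nOm; rewrite /Phi memNset ?memNset //.
  by move=> /sub.
have ins x : closure Om' x -> Phi x = c2 by move=> h; rewrite /Phi mem_set.
have D_out x : closure D x -> ~ Om' x.
  move=> clx Ox; have nOm' : nbhs x Om' by apply: open_nbhs_nbhs.
  by have [y [[_ +] /subset_closure]] := clx _ nOm'.
have eqD x : closure D x -> Phi x = phi x.
  move=> clx; have [h|h] := pselect (closure Om' x).
    by rewrite ins // phi2 //; exact: D_out.
  have [h'|h'] := pselect (Om x).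
    by rewrite /Phi memNset // mem_set.
  rewrite out // phi1 //; apply: closure_subset clx; exact: subDsetl.
exists Phi; split=> //.
apply/continuous_subspace_setT.
(* Three closed sets cover the space, and on each [Phi] agrees with a continuous function, so the
   pieces glue. *)
have -> : [set: T] = closure D `|` (closure Om' `|` ~` Om).
  apply/seteqP; split=> // x _.
  have [h|h] := pselect (closure Om' x); first by right; left.
  have [h'|h'] := pselect (Om x); last by right; right.
  by left; apply: subset_closure.
have eqc (A : set T) (g : T -> R) : {in A, Phi =1 g} -> {within A, continuous g} ->
    {within A, continuous Phi}.
  by move=> h; apply: subspace_eq_continuous => x xA; rewrite [LHS](esym (h x xA)).
apply: withinU_continuous.
- exact: closed_closure.
- by apply: closedU; [exact: closed_closure | exact: open_closedC].
- by apply: (eqc _ phi) => // x /set_mem /eqD.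
apply: withinU_continuous.
- exact: closed_closure.
- exact: open_closedC.
- apply: (eqc _ (fun=> c2)); first by move=> x /set_mem /ins.
  by apply: continuous_subspaceT => ?; exact: cvg_cst.
- apply: (eqc _ (fun=> c1)); first by move=> x /set_mem /out.
  by apply: continuous_subspaceT => ?; exact: cvg_cst.
Qed.

(** * Reduction of the theorem to the moving-plane result *)

Theorem proposition1p14 (R : realType)
  (Xi Xi' Omega Omega' : set 'rV[R]_2)
  (hXi : C1_jordan_curve Xi) (hXi' : C1_jordan_curve Xi')
  (hOmega : bounded_component_of_compl Xi Omega)
  (hOmega' : bounded_component_of_compl Xi' Omega')
  (Xi_surrounds_0 : Omega 0) (Xi'_surrounds_0 : Omega' 0)
  (hsub : closure Omega' `<=` Omega)
  (omega : set 'rV[R]_2) (homega : omega = Omega `\` closure Omega')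
  (Rmin Rmax : R)
  (hRmin : is_min [set enorm x | x in Xi'] Rmin)
  (hRmax : is_max [set enorm x | x in Xi] Rmax)
  (e : 'rV[R]_2) (he : enorm e = 1)
  (lambdabar : R) (hlambdabar : is_max [set dotp x e | x in Xi] lambdabar)
  (eps : R) (heps : 0 <= eps < lambdabar)
  (c1 c2 : R) (hc : c1 < c2)
  (F : R -> R -> R)
  (F_cont : {within `[Rmin, Rmax] `*` `[c1, c2],
               continuous (fun p : R * R => F p.1 p.2)})
  (F_noninc : forall r1 r2 s : R, Rmin <= r1 -> r1 <= r2 -> r2 <= Rmax ->
     c1 <= s <= c2 -> F r2 s <= F r1 s)
  (F_lip : exists k : R, forall r : R, Rmin <= r <= Rmax ->
     k.-lipschitz_(`[c1, c2]) (F r))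
  (phi : 'rV[R]_2 -> R) (phi_C2 : C2_closure omega phi)
  (phi_eq : forall x, closure omega x ->
     laplacian_closure omega phi x + F (enorm x) (phi x) = 0)
  (phi_in : forall x, omega x -> c1 < phi x < c2)
  (phi_Xi : forall x, Xi x -> phi x = c1)
  (phi_Xi' : forall x, Xi' x -> phi x = c2)
  (hrefl : forall lambda : R, eps < lambda ->
     refl e lambda @` (halfplane e lambda `&` closure Omega) `<=` Omega)
  (hrefl' : forall lambda : R, eps < lambda ->
     refl e lambda @` (halfplane e lambda `&` Xi') `<=` Omega') :
  forall lambda : R, eps <= lambda < lambdabar ->
  forall x, closure ((halfplane e lambda `&` omega)
                       `\` refl e lambda @` closure Omega') x ->
    phi x <= phi (refl e lambda x).
Proof.
have [eps0 epslb] := andP heps.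
have e_unit := dotp_enorm1 he.
have [[p0 _ OmegaE] bOmega] := hOmega.
have [[p0' _ OmegaE'] bOmega'] := hOmega'.
have oC : open (~` Xi) := closed_openC (C1_jordan_curve_closed hXi).
have oC' : open (~` Xi') := closed_openC (C1_jordan_curve_closed hXi').
have oOm : open Omega by rewrite OmegaE; exact: open_component.
have oOm' : open Omega' by rewrite OmegaE'; exact: open_component.
have bdry x : closure Omega x -> ~ Omega x -> Xi x.
  rewrite OmegaE => h1 h2; apply: contrapT => h3.
  by apply: h2; exact: closure_component.
have bdry' x : closure Omega' x -> ~ Omega' x -> Xi' x.
  rewrite OmegaE' => h1 h2; apply: contrapT => h3.
  by apply: h2; exact: closure_component.
have e_neq0 : e != 0.
  by apply/eqP => e0; move: e_unit; rewrite e0 dot0p => /esym /eqP; rewrite oner_eq0.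
have ray x v : Omega x -> v != 0 -> exists2 t : R, 0 <= t & Xi (x + t *: v).
  by move: bOmega; rewrite OmegaE; exact: component_ray.
have ray' x v : Omega' x -> v != 0 -> exists2 t : R, 0 <= t & Xi' (x + t *: v).
  by move: bOmega'; rewrite OmegaE'; exact: component_ray.
(* Moving in direction [e] until the curve is met only increases the scalar product with [e]; the
   radial ray serves likewise for [Rmax]. *)
have Omega_lb x : Omega x -> dotp x e <= lambdabar.
  move=> Ox; have [t t0 Xt] := ray x e Ox e_neq0.
  have := hlambdabar.2 _ (ex_intro2 _ _ _ Xt erefl).
  by rewrite dotpDl dotpZl e_unit mulr1; apply: le_trans; rewrite lerDl.
have Omega_Rmax x : Omega x -> enorm x <= Rmax.
  have [->|x0 Ox] := eqVneq x 0.
    move=> _; have [[y _ <-] _] := hRmax.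
    by rewrite /enorm dot0p sqrtr0 sqrtr_ge0.
  have [t t0 Xt] := ray x x Ox x0.
  have := hRmax.2 _ (ex_intro2 _ _ _ Xt erefl).
  rewrite -{1}[x]scale1r -scalerDl enormZ ?addr_ge0 //; apply: le_trans.
  by rewrite ler_peMl ?sqrtr_ge0 // lerDl.
(* If [|x| < Rmin], the segment from the origin to [x] misses [Xi'], so [x] lies in [Omega']. *)
have omega_Rmin x : ~ closure Omega' x -> Rmin <= enorm x.
  move=> nx; apply: contrapT => nR; apply: nx; apply: subset_closure.
  have O0 := Xi'_surrounds_0; rewrite OmegaE' in O0 *; rewrite -[x]add0r.
  apply: component_segment O0 _ => t /andP[t0 t1] Xt; apply: nR.
  apply: le_trans (hRmin.2 _ (ex_intro2 _ _ _ Xt erefl)) _.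
  by rewrite add0r enormZ // ler_piMl // sqrtr_ge0.
have refl_Omega l x : eps < l -> l < dotp x e -> closure Omega x -> Omega (refl e l x).
  by move=> el lx Ox; apply: (hrefl _ el); exists x.
have refl_Xi' l x : eps < l -> l < dotp x e -> Xi' x -> Omega' (refl e l x).
  by move=> el lx Xx; apply: (hrefl' _ el); exists x.
(* For x in Omega', the ray x + t e leaves Omega' at some y in Xi', and x_l is
   also the reflection of y in the line x . e = l + t / 2. *)
have refl_Omega' l x : eps < l -> l < dotp x e -> Omega' x -> Omega' (refl e l x).
  move=> el lx Ox; have [t t0 Xt] := ray' x e Ox e_neq0.
  have -> : refl e l x = refl e (l + t / 2) (x + t *: e).
    by apply: rV2P; rewrite /refl !mxE dotpDl dotpZl e_unit; field.
  by apply: refl_Xi' Xt; rewrite ?dotpDl ?dotpZl ?e_unit; lra.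
have oom : open omega.
  rewrite homega setDE; apply: openI => //.
  exact/closed_openC/closed_closure.
have om_Om x : omega x -> Omega x by rewrite homega => -[].
have clom_Om x : closure omega x -> closure Omega x by apply: closure_subset.
have clom_Om' x : closure omega x -> ~ Omega' x.
  move=> clx Ox; have nO : nbhs x Omega' by apply: open_nbhs_nbhs.
  by have [y []] := clx _ nO; rewrite homega => -[_ +] /subset_closure.
have [Phi [cPhi Phi_phi Phi_c1 Phi_c2]] : exists Phi : 'rV[R]_2 -> R, [/\ continuous Phi,
    forall x, closure omega x -> Phi x = phi x,
    forall x, ~ Omega x -> Phi x = c1 & forall x, closure Omega' x -> Phi x = c2].
  rewrite homega; apply: extension_by_constants => //.
  - by rewrite -homega; case: phi_C2.
  - by move=> x h1 h2; apply/phi_Xi/bdry.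
  - by move=> x h1 h2; apply/phi_Xi'/bdry'.
have Phi_om x : omega x -> Phi x = phi x by move=> /subset_closure /Phi_phi.
have omP x : Omega x -> ~ closure Omega' x -> omega x by rewrite homega.
have Phi_bounds x : c1 <= Phi x <= c2.
  have [h|h] := pselect (closure Omega' x); first by rewrite Phi_c2 // lexx ltW.
  have [h'|h'] := pselect (Omega x); last by rewrite Phi_c1 // lexx ltW.
  have ox := omP _ h' h; have /andP[] := phi_in _ ox.
  by rewrite Phi_om // => /ltW -> /ltW ->.
have [K K0 laplacian_diff] : exists2 K : R, 0 < K &
    forall l x, eps < l -> l <= dotp x e -> omega x -> omega (refl e l x) ->
    laplacian_closure omega phi (refl e l x) - laplacian_closure omega phi x
    <= K * `|Phi (refl e l x) - Phi x|.
  (* The sign of [k] is unspecified, and a positive constant is required. *)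
  have [k lipF] := F_lip; exists (`|k| + 1); first by rewrite ltr_wpDl.
  move=> l x el lx ox ox'; rewrite !Phi_om //.
  have eqn y : omega y -> laplacian_closure omega phi y = - F (enorm y) (phi y).
    by move=> oy; apply/eqP; rewrite -addr_eq0 phi_eq //; exact: subset_closure.
  rewrite !eqn // opprK addrC.
  have phic y : omega y -> c1 <= phi y <= c2.
    by move=> oy; have /andP[/ltW -> /ltW ->] := phi_in _ oy.
  have Rx : Rmin <= enorm x <= Rmax.
    rewrite Omega_Rmax ?omega_Rmin //; last exact: om_Om.
    by move: ox; rewrite homega => -[].
  have Rx' : Rmin <= enorm (refl e l x).
    by apply: omega_Rmin; move: ox'; rewrite homega => -[].
  have le_x : enorm (refl e l x) <= enorm x.
    by apply: enorm_refl => //; apply: le_trans eps0 (ltW el).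
  have /andP[_ Rx2] := Rx.
  (* Since [F] is nonincreasing in the radius, the smaller radius of the reflected point may be
     replaced by that of [x]; the Lipschitz bound then applies at one radius. *)
  apply: (@le_trans _ _ (F (enorm x) (phi x) - F (enorm x) (phi (refl e l x)))).
    by rewrite lerD2l lerN2; apply: F_noninc => //; exact: phic.
  apply: le_trans (ler_norm _) _; rewrite distrC.
  have := lipF _ Rx (phi (refl e l x), phi x).
  rewrite /= !in_itv /= !phic // => /(_ (conj isT isT)) H; apply: le_trans H _.
  apply: ler_wpM2r => //; apply: le_trans (ler_norm _) _.
  by rewrite lerDl.
have clOm'P x : closure Omega' x -> Omega' x \/ Xi' x.
  move=> h; have [?|?] := pselect (Omega' x); first by left.
  by right; exact: bdry'.
(* A strict decrease excludes the maximum [c2] at the reflected point and the minimum [c1] at [x];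
   the reflection hypotheses settle the remaining two positions. *)
have neg_interior l x : eps < l -> l <= dotp x e ->
    Phi (refl e l x) < Phi x -> omega x /\ omega (refl e l x).
  move=> el; rewrite le_eqVlt => /predU1P[h|lx neg].
    by rewrite refl_fixed // ltxx.
  have nOx' : ~ closure Omega' (refl e l x).
    move=> /Phi_c2 h; move: neg; rewrite h ltNge.
    by have /andP[_ ->] := Phi_bounds x.
  have Ox : Omega x.
    apply: contrapT => /Phi_c1 h; move: neg; rewrite h ltNge.
    by have /andP[-> _] := Phi_bounds (refl e l x).
  split; apply: omP => //.
    move=> /clOm'P h; apply: nOx'; apply: subset_closure.
    by case: h; [exact: refl_Omega'|exact: refl_Xi'].
  by apply: refl_Omega => //; exact: subset_closure.
(* Equality is now allowed, so strictness comes from [c1 < Phi] at the reflected point, which lies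
   in [Omega], and from [phi < c2] in [omega]. *)
have nonpos_interior l x : eps < l -> l < dotp x e ->
    closure omega x -> closure omega (refl e l x) -> Phi (refl e l x) <= Phi x ->
    omega x /\ omega (refl e l x).
  move=> el lx clx clx' nonpos.
  have Ox' : Omega (refl e l x) by apply: refl_Omega => //; exact: clom_Om.
  have c1_lt : c1 < Phi (refl e l x).
    have [h|h] := pselect (closure Omega' (refl e l x)); first by rewrite Phi_c2.
    have ox := omP _ Ox' h; have /andP[h1 _] := phi_in _ ox.
    by rewrite Phi_om.
  have Ox : Omega x.
    apply: contrapT => /Phi_c1 h; move: nonpos; rewrite h leNgt.
    by rewrite c1_lt.
  have nOx : ~ closure Omega' x.
    move=> /clOm'P [/(clom_Om' _ clx) //|Xx].
    by apply: (clom_Om' _ clx'); exact: refl_Xi'.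
  have ox := omP _ Ox nOx; split=> //; apply: omP => //.
  move=> /Phi_c2 h; move: nonpos; rewrite h Phi_om // leNgt.
  by have /andP[_ ->] := phi_in _ ox.
have om_bounded : bounded_set omega.
  have [M [Mr bM]] := bOmega; exists M; split=> // r /bM h x /om_Om; exact: h.
have om_lb x : closure omega x -> dotp x e <= lambdabar.
  have cl : closed [set y | dotp y e <= lambdabar].
    by apply: closed_le_fun; [exact: dote_continuous|exact: continuous_fun_cst].
  by move=> clx; apply: cl; apply: closure_subset clx => y /om_Om /Omega_lb.
move=> lambda hl x clx.
have main := moving_planes oom om_bounded phi_C2 cPhi Phi_om he K0 om_lb
  neg_interior nonpos_interior laplacian_diff hl.
have clhp : closed [set y : 'rV[R]_2 | lambda <= dotp y e].
  by apply: closed_le_fun; [exact: continuous_fun_cst|exact: dote_continuous].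
have lx : lambda <= dotp x e.
  by apply: clhp; apply: closure_subset clx => y [[/ltW h _] _].
have clox : closure omega x by apply: closure_subset clx => y [[_ h] _].
(* Needed to read [Phi] as [phi] at the reflected point too. *)
have clox' : closure omega (refl e lambda x).
  have cl : closed [set y | closure omega (refl e lambda y)].
    by apply: closed_preimage; [exact: refl_continuous|exact: closed_closure].
  apply: cl; apply: closure_subset clx => y [[ly oy] ny] /=.
  have nOy : ~ closure Omega' (refl e lambda y).
    by move=> h; apply: ny; exists (refl e lambda y) => //; exact: reflK.
  have clOy : closure Omega (refl e lambda y).
    apply: contrapT => nOl.
    have ck : continuous (fun k : R => refl e k y).
      apply: (@continuous_refl R e _ (fun=> y) (fun k => k)).
        exact: continuous_fun_cst.
      exact: continuous_fun_id.
    have oOc : open (~` closure Omega) by exact/closed_openC/closed_closure.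
    have /nbhs_ballP[r /= r0 near_l] := near_preimage ck oOc nOl.
    rewrite /halfplane /= in ly.
    pose s := Num.min r (dotp y e - lambda).
    have s0 : 0 < s by rewrite lt_min r0 subr_gt0 ly.
    have [h1 h2] : s <= r /\ s <= dotp y e - lambda by rewrite /s !ge_min !lexx !orbT.
    have [el _] := andP hl.
    apply: (near_l (lambda + s / 2)).
      by rewrite -ball_normE /= opprD addNKr normrN gtr0_norm; lra.
    apply: subset_closure; apply: refl_Omega.
    - by apply: le_lt_trans el _; rewrite ltrDl; lra.
    - lra.
    - by apply: subset_closure; exact: om_Om.
  move=> V nV.
  have nO : nbhs (refl e lambda y) (~` closure Omega').
    by apply: open_nbhs_nbhs; split=> //; exact/closed_openC/closed_closure.
  have [u [Ou [Vu nu]]] := clOy _ (filterI nV nO).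
  by exists u; split=> //; exact: omP.
by rewrite -(Phi_phi _ clox) -(Phi_phi _ clox'); exact: main.
Qed.
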